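(* Let $X$ be a path-connected space, $x_0\in X$, and $H\leq \pi_1(X,x_0)$. Suppose that $X$ is an $H$-SLT space at $x_0$ and that $H$ is locally quasinormal. If $X$ is homotopically Hausdorff relative to $H$, then $X$ is homotopically path Hausdorff relative to $H$.
   Context: For a point $y\in X$, $P(X,y)$ denotes the set of paths $[0,1]\to X$ starting at $y$; $[\cdot]$ denotes path-homotopy class rel endpoints, $\ast$ is concatenation, and $\bar\alpha$ is the reverse of $\alpha$. For an open set $U\ni y$, $i_\#\pi_1(U,y)\leq\pi_1(X,y)$ is the image of $\pi_1(U,y)$ under the inclusion. For $\alpha\in P(X,y)$ and an open set $V\ni\alpha(1)$, put $\pi(\alpha,V)=\{[\alpha\ast\delta\ast\bar\alpha] : \delta \text{ a loop in } V \text{ based at } \alpha(1)\}\leq\pi_1(X,y)$. Let $H\leq\pi_1(X,x_0)$. $H$ is locally quasinormal if for every $\alpha\in P(X,x_0)$ and every open $U\ni\alpha(1)$ there is an open $V$ with $\alpha(1)\in V\subseteq U$ and $H\pi(\alpha,V)=\pi(\alpha,V)H$ (equality of product sets). $X$ is $H$-SLT (an $H$-small loop transfer space) at $x_0$ if for every $\alpha\in P(X,x_0)$ and every open $U\ni x_0$ there is an open $V\ni\alpha(1)$ with $\pi(\alpha,V)\subseteq H\, i_\#\pi_1(U,x_0)$. $X$ is homotopically Hausdorff relative to $H$ if for every $\alpha\in P(X,x_0)$ and every $g\in\pi_1(X,x_0)\setminus H$ there is an open $U\ni\alpha(1)$ with $\pi(\alpha,U)\cap Hg=\emptyset$. $X$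 is homotopically path Hausdorff relative to $H$ if for all $\alpha,\beta\in P(X,x_0)$ with $\alpha(1)=\beta(1)$ and $[\alpha]\notin H[\beta]$ there are a partition $0=t_0<t_1<\dots<t_n=1$ and open sets $U_1,\dots,U_n\subseteq X$ with $\alpha([t_{i-1},t_i])\subseteq U_i$ for $1\le i\le n$, such that every path $\lambda$ with $\lambda([t_{i-1},t_i])\subseteq U_i$ for $1\le i\le n$ and $\lambda(t_i)=\alpha(t_i)$ for $0\le i\le n$ satisfies $[\lambda]\notin H[\beta]$. *)

(* Defs.v *)
From HB Require Import structures.
From mathcomp Require Import all_boot all_order all_algebra generic_quotient.
From mathcomp Require Import all_classical all_reals all_analysis homotopy.
From mathcomp Require Import lra.
Set Implicit Arguments.
Unset Strict Implicit.
Unset Printing Implicit Defensive.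
Import Order.TTheory GRing.Theory Num.Theory.
Import numFieldNormedType.Exports.
Local Open Scope classical_set_scope.
Local Open Scope ring_scope.
Local Open Scope quotient_scope.

Definition unitI (R : realType) : Type := set_type `[0 : R, 1]%classic.

HB.instance Definition _ (R : realType) := Topological.on (unitI R).

Section UnitInterval.
Variable R : realType.
Local Notation I := (unitI R).

Definition ival (s : I) : R := \val s.

Lemma ival_ge0 s : 0 <= ival s.
Proof. by have := set_valP s; rewrite /= in_itv /= => /andP[]. Qed.

Lemma ival_le1 s : ival s <= 1.
Proof. by have := set_valP s; rewrite /= in_itv /= => /andP[]. Qed.

Lemma ival_inj : injective ival.
Proof. exact: val_inj. Qed.

Lemma ival_continuous : continuous ival.
Proof. exact: initial_continuous. Qed.

Lemma clamp_subproof (r : R) :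
  Num.max 0 (Num.min r 1) \in `[0 : R, 1]%classic.
Proof.
apply/mem_set => /=; rewrite in_itv /= le_max lexx /=.
by rewrite ge_max ler01 /= ge_min lexx orbT.
Qed.

(* The nearest-point retraction of R onto [0, 1]. *)
Definition clamp (r : R) : I := SigSub (clamp_subproof r).

Lemma ival_clamp r : ival (clamp r) = Num.max 0 (Num.min r 1).
Proof. by []. Qed.

Lemma clampK s : clamp (ival s) = s.
Proof.
apply: ival_inj; rewrite ival_clamp min_l ?ival_le1 //.
by rewrite max_r // ival_ge0.
Qed.

Lemma ival_clamp_id r : 0 <= r -> r <= 1 -> ival (clamp r) = r.
Proof. by move=> r0 r1; rewrite ival_clamp min_l // max_r. Qed.

Lemma clamp_le0 r : r <= 0 -> clamp r = clamp 0.
Proof.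
move=> r0; apply: ival_inj; rewrite !ival_clamp.
rewrite min_l ?(le_trans r0) // max_l // min_l // max_l //.
Qed.

Lemma clamp_ge1 r : 1 <= r -> clamp r = clamp 1.
Proof. by move=> r1; apply: ival_inj; rewrite !ival_clamp !min_r. Qed.

Lemma clamp_continuous : continuous clamp.
Proof.
apply: continuous_comp_initial => r.
apply: (@continuous_max R R (cst 0) (fun r => Num.min r 1)).
  exact: cvg_cst.
apply: (@continuous_min R R id (cst 1)); [exact: cvg_id|exact: cvg_cst].
Qed.

Lemma unitI_zero_neq_one : clamp 0 != clamp 1.
Proof.
apply/eqP => /(congr1 ival); rewrite !ival_clamp_id // => /esym/eqP.
by rewrite oner_eq0.
Qed.

HB.instance Definition _ :=
  isBiPointed.Build I unitI_zero_neq_one.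

End UnitInterval.

Notation ipath R x y := {path (unitI R) from x to y}.

Section Pasting.
Variables (R : realType) (T X : topologicalType).

Lemma continuous_paste (c : T -> R) (r : R) (f g : T -> X) :
  continuous c -> continuous f -> continuous g ->
  (forall s, c s = r -> f s = g s) ->
  continuous (fun s => if c s <= r then f s else g s).
Proof.
move=> cc cf cg fg.
set h := fun s => _.
have cA : closed [set s | c s <= r].
  by apply: (@preimage_closed _ _ c [set x | x <= r]) => //; exact: closed_le.
have cB : closed [set s | r <= c s].
  by apply: (@preimage_closed _ _ c [set x | r <= x]) => //; exact: closed_ge.
have : {within [set s | c s <= r] `|` [set s | r <= c s], continuous h}.
  apply: withinU_continuous => //.
    apply: (@subspace_eq_continuous _ _ _ f).
      by move=> s /set_mem /= sr; rewrite /h /from_subspace /= sr.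
    exact: continuous_subspaceT.
  apply: (@subspace_eq_continuous _ _ _ g).
    move=> s /set_mem /= sr; rewrite /h /from_subspace /=.
    by case: ifPn => // rs; rewrite fg //; apply/eqP; rewrite eq_le rs.
  exact: continuous_subspaceT.
have -> : [set s | c s <= r] `|` [set s | r <= c s] = [set: T].
  by apply/seteqP; split => // s _ /=; apply/orP; exact: le_total.
by move=> ch; exact/continuous_subspace_setT.
Qed.

Lemma continuous_clamp (c : T -> R) :
  continuous c -> continuous (fun s => clamp (c s)).
Proof.
by move=> cc s; apply: (@continuous_comp _ _ _ c); [exact: cc|exact: clamp_continuous].
Qed.

Lemma continuous_ival (c : T -> unitI R) :
  continuous c -> continuous (fun s => ival (c s)).
Proof.
by move=> cc s; apply: (@continuous_comp _ _ _ c); [exact: cc|exact: ival_continuous].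
Qed.

Lemma continuous_after (U : topologicalType) (c : T -> U) (f : U -> X) :
  continuous c -> continuous f -> continuous (fun s => f (c s)).
Proof.
by move=> cc cf s; apply: (@continuous_comp _ _ _ c f); [exact: cc|exact: cf].
Qed.

Lemma continuous_pairing (U : topologicalType) (f : T -> X) (g : T -> U) :
  continuous f -> continuous g -> continuous (fun s => (f s, g s)).
Proof. by move=> cf cg s; apply: cvg_pair; [exact: cf|exact: cg]. Qed.

Lemma continuous_fst : continuous (@fst T X).
Proof. by move=> s; exact: cvg_fst. Qed.

Lemma continuous_snd : continuous (@snd T X).
Proof. by move=> s; exact: cvg_snd. Qed.

Lemma continuous_affine (a b : R) (c : T -> R) :
  continuous c -> continuous (fun s => a * c s + b).
Proof.
move=> cc s; apply: cvgD; last exact: cvg_cst.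
by apply: cvgM; [exact: cvg_cst|exact: cc].
Qed.

Lemma continuous_addf (c d : T -> R) :
  continuous c -> continuous d -> continuous (fun s => c s + d s).
Proof. by move=> cc cd s; apply: cvgD; [exact: cc|exact: cd]. Qed.

Lemma continuous_mulf (c d : T -> R) :
  continuous c -> continuous d -> continuous (fun s => c s * d s).
Proof. by move=> cc cd s; apply: cvgM; [exact: cc|exact: cd]. Qed.

Lemma continuous_minf (c d : T -> R) :
  continuous c -> continuous d -> continuous (fun s => Num.min (c s) (d s)).
Proof. by move=> cc cd s; apply: continuous_min; [exact: cc|exact: cd]. Qed.

End Pasting.

Section Paths.
Variables (R : realType) (X : topologicalType).
Local Notation I := (unitI R).

Lemma clamp0 : clamp (0 : R) = zero.
Proof. by []. Qed.

Lemma clamp1 : clamp (1 : R) = one.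
Proof. by []. Qed.

Lemma ival_zero : ival (zero : I) = 0.
Proof. by rewrite -clamp0 ival_clamp_id. Qed.

Lemma ival_one : ival (one : I) = 1.
Proof. by rewrite -clamp1 ival_clamp_id. Qed.

Definition cat_fun (f g : I -> X) (s : I) : X :=
  if ival s <= 2^-1 then f (clamp (2 * ival s)) else g (clamp (2 * ival s - 1)).

Lemma cat_fun_continuous f g : continuous f -> continuous g ->
  f one = g zero -> continuous (cat_fun f g).
Proof.
move=> cf cg fg; apply: (@continuous_paste R I X (@ival R)).
- exact: ival_continuous.
- have -> : (fun s : I => f (clamp (2 * ival s))) =
            (fun s => f (clamp (2 * ival s + 0))).
    by apply/funext => s; rewrite addr0.
  apply: continuous_after cf; apply: continuous_clamp.
  by apply: continuous_affine; exact: ival_continuous.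
- apply: continuous_after cg; apply: continuous_clamp.
  by apply: continuous_affine; exact: ival_continuous.
- by move=> s ->; rewrite divff ?pnatr_eq0 // subrr clamp0 clamp1.
Qed.

Lemma cat_fun_zero f g : cat_fun f g zero = f zero.
Proof. by rewrite /cat_fun ival_zero invr_ge0 ler0n mulr0. Qed.

Lemma cat_fun_one f g : cat_fun f g one = g one.
Proof.
rewrite /cat_fun ival_one ifF; last by apply/negbTE; rewrite -ltNge; lra.
by rewrite mulr1 (_ : 2 - 1 = 1 :> R) //; lra.
Qed.

Section PathCat.
Variables (x y z : X) (p : ipath R x y) (q : ipath R y z).

Let cat_continuous : continuous (cat_fun p q).
Proof.
by apply: cat_fun_continuous; rewrite ?path_one ?path_zero //; exact: cts_fun.
Qed.

Let cat_zero : cat_fun p q zero = x.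
Proof. by rewrite cat_fun_zero path_zero. Qed.

Let cat_one : cat_fun p q one = z.
Proof. by rewrite cat_fun_one path_one. Qed.

Definition path_cat : ipath R x z := mk_path cat_continuous cat_zero cat_one.

Lemma path_catE s : path_cat s = cat_fun p q s.
Proof. by []. Qed.

End PathCat.

Definition irev (s : I) : I := clamp (1 - ival s).

Lemma irev_continuous : continuous irev.
Proof.
have -> : irev = fun s => clamp (-1 * ival s + 1).
  by apply/funext => s; rewrite /irev mulN1r addrC.
apply: continuous_clamp; apply: continuous_affine; exact: ival_continuous.
Qed.

Lemma irev_zero : irev zero = one.
Proof. by rewrite /irev ival_zero subr0. Qed.

Lemma irev_one : irev one = zero.
Proof. by rewrite /irev ival_one subrr. Qed.

Section PathRev.
Variables (x y : X) (p : ipath R x y).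

Let rev_continuous : continuous (p \o irev).
Proof. apply: continuous_after irev_continuous _; exact: cts_fun. Qed.

Let rev_zero : (p \o irev) zero = y.
Proof. by rewrite /= irev_zero path_one. Qed.

Let rev_one : (p \o irev) one = x.
Proof. by rewrite /= irev_one path_zero. Qed.

Definition path_rev : ipath R y x := mk_path rev_continuous rev_zero rev_one.

Lemma path_revE s : path_rev s = p (irev s).
Proof. by []. Qed.

End PathRev.

Definition path_cst (x : X) : ipath R x x := [the ipath R x x of cst x].

(* Homotopy relative to the endpoints; the second variable is the time. *)
Definition path_homotopic (x y : X) (p q : ipath R x y) : Prop :=
  exists F : I * I -> X, [/\ continuous F,
    forall s, F (s, zero) = p s, forall s, F (s, one) = q s,
    forall t, F (zero, t) = x & forall t, F (one, t) = y].

End Paths.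

Arguments path_cst : clear implicits.

Section HomotopyTheory.
Variables (R : realType) (X : topologicalType).
Local Notation I := (unitI R).
Implicit Types x y z w : X.

Lemma path_reparam (f : I -> X) (phi psi : I -> I)
    (a b : X) (p q : ipath R a b) :
  continuous f -> continuous phi -> continuous psi ->
  phi zero = psi zero -> phi one = psi one ->
  (forall s, p s = f (phi s)) -> (forall s, q s = f (psi s)) ->
  path_homotopic p q.
Proof.
move=> cf cphi cpsi e0 e1 pE qE.
pose w (u : I * I) : R :=
  ival (phi u.1) + ival u.2 * (ival (psi u.1) + -1 * ival (phi u.1)).
have cw : continuous w.
  have c1 (g : I -> I) : continuous g -> continuous (fun u : I * I => ival (g u.1)).
    move=> cg; apply: continuous_ival; apply: continuous_after cg.
    exact: continuous_fst.
  apply: continuous_addf; first exact: c1.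
  apply: continuous_mulf.
    by apply: continuous_ival; exact: continuous_snd.
  apply: continuous_addf; first exact: c1.
  apply: continuous_mulf; last exact: c1.
  by move=> u; exact: cvg_cst.
exists (f \o (@clamp R \o w)); split.
- by apply: continuous_after cf; exact: continuous_clamp.
- move=> s; rewrite pE /= /w /= ival_zero mul0r addr0 clampK //.
- move=> s; rewrite qE /= /w /= ival_one mul1r mulN1r addrCA subrr addr0.
  by rewrite clampK.
- move=> t; rewrite -(path_zero (s := p)) pE /= /w /= e0 mulN1r subrr mulr0.
  by rewrite addr0 clampK.
- move=> t; rewrite -(path_one (s := p)) pE /= /w /= e1 mulN1r subrr mulr0.
  by rewrite addr0 clampK.
Qed.

Lemma path_homotopic_refl x y (p : ipath R x y) : path_homotopic p p.
Proof.
exists (p \o fst); split => //=.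
- apply: continuous_after; [exact: continuous_fst|exact: cts_fun].
- by move=> _; exact: path_zero.
- by move=> _; exact: path_one.
Qed.

Lemma path_homotopic_sym x y (p q : ipath R x y) :
  path_homotopic p q -> path_homotopic q p.
Proof.
move=> [F [cF F0 F1 Fx Fy]]; exists (fun u => F (u.1, irev u.2)); split => /=.
- apply: continuous_after cF; apply: continuous_pairing.
    exact: continuous_fst.
  by apply: continuous_after (@irev_continuous R); exact: continuous_snd.
- by move=> s; rewrite irev_zero.
- by move=> s; rewrite irev_one.
- by move=> t; rewrite Fx.
- by move=> t; rewrite Fy.
Qed.

Let dbl_continuous (b : R) (T : topologicalType) (c : T -> I) :
  continuous c -> continuous (fun s => clamp (2 * ival (c s) + b)).
Proof.
move=> cc; apply: continuous_clamp; apply: continuous_affine.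
exact: continuous_ival.
Qed.

Lemma path_homotopic_trans x y (q p r : ipath R x y) :
  path_homotopic p q -> path_homotopic q r -> path_homotopic p r.
Proof.
move=> [F [cF F0 F1 Fx Fy]] [G [cG G0 G1 Gx Gy]].
exists (fun u : I * I => if ival u.2 <= 2^-1
  then F (u.1, clamp (2 * ival u.2 + 0)) else G (u.1, clamp (2 * ival u.2 + -1))).
split => /=.
- apply: continuous_paste.
  + by apply: continuous_ival; exact: continuous_snd.
  + apply: continuous_after cF; apply: continuous_pairing.
      exact: continuous_fst.
    by apply: dbl_continuous; exact: continuous_snd.
  + apply: continuous_after cG; apply: continuous_pairing.
      exact: continuous_fst.
    by apply: dbl_continuous; exact: continuous_snd.
  + move=> [s t] /= ->; rewrite divff ?pnatr_eq0 // addr0 subrr.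
    by rewrite clamp0 clamp1 F1 G0.
- by move=> s; rewrite ival_zero invr_ge0 ler0n mulr0 addr0 clamp0.
- move=> s; rewrite ival_one ifF; last by apply/negbTE; rewrite -ltNge; lra.
  by rewrite (_ : 2 * 1 + -1 = 1 :> R) ?clamp1 //; lra.
- by move=> t; rewrite Fx Gx if_same.
- by move=> t; rewrite Fy Gy if_same.
Qed.

Lemma path_homotopic_cat x y z (p p' : ipath R x y) (q q' : ipath R y z) :
  path_homotopic p p' -> path_homotopic q q' ->
  path_homotopic (path_cat p q) (path_cat p' q').
Proof.
move=> [F [cF F0 F1 Fx Fy]] [G [cG G0 G1 Gx Gy]].
exists (fun u : I * I => if ival u.1 <= 2^-1
  then F (clamp (2 * ival u.1 + 0), u.2) else G (clamp (2 * ival u.1 + -1), u.2)).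
split => /=.
- apply: continuous_paste.
  + by apply: continuous_ival; exact: continuous_fst.
  + apply: continuous_after cF; apply: continuous_pairing.
      by apply: dbl_continuous; exact: continuous_fst.
    exact: continuous_snd.
  + apply: continuous_after cG; apply: continuous_pairing.
      by apply: dbl_continuous; exact: continuous_fst.
    exact: continuous_snd.
  + move=> [s t] /= ->; rewrite divff ?pnatr_eq0 // addr0 subrr.
    by rewrite clamp0 clamp1 Fy Gx.
- by move=> s; rewrite path_catE /cat_fun addr0 F0 G0.
- by move=> s; rewrite path_catE /cat_fun addr0 F1 G1.
- by move=> t; rewrite ival_zero invr_ge0 ler0n mulr0 addr0 clamp0.
- move=> t; rewrite ival_one ifF; last by apply/negbTE; rewrite -ltNge; lra.
  by rewrite (_ : 2 * 1 + -1 = 1 :> R) ?clamp1 //; lra.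
Qed.

Lemma path_homotopic_rev x y (p q : ipath R x y) :
  path_homotopic p q -> path_homotopic (path_rev p) (path_rev q).
Proof.
move=> [F [cF F0 F1 Fx Fy]]; exists (fun u => F (irev u.1, u.2)); split => /=.
- apply: continuous_after cF; apply: continuous_pairing.
    by apply: continuous_after (@irev_continuous R); exact: continuous_fst.
  exact: continuous_snd.
- by move=> s; rewrite F0.
- by move=> s; rewrite F1.
- by move=> t; rewrite irev_zero.
- by move=> t; rewrite irev_one.
Qed.

Lemma path_cat1p x y (p : ipath R x y) :
  path_homotopic (path_cat (path_cst R X x) p) p.
Proof.
apply: (@path_reparam p (fun s => clamp (2 * ival s + -1)) id).
- exact: cts_fun.
- by apply: dbl_continuous => s; exact: cvg_id.
- by move=> s; exact: cvg_id.
- by rewrite ival_zero mulr0 add0r clamp_le0 ?clamp0 //; lra.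
- by rewrite ival_one (_ : 2 * 1 + -1 = 1 :> R) ?clamp1 //; lra.
- move=> s; rewrite path_catE /cat_fun; case: ifPn => // hs.
  rewrite [X in _ = p X]clamp_le0; last by lra.
  by rewrite [RHS]path_zero.
- by [].
Qed.

Lemma path_catp1 x y (p : ipath R x y) :
  path_homotopic (path_cat p (path_cst R X y)) p.
Proof.
apply: (@path_reparam p (fun s => clamp (2 * ival s + 0)) id).
- exact: cts_fun.
- by apply: dbl_continuous => s; exact: cvg_id.
- by move=> s; exact: cvg_id.
- by rewrite ival_zero mulr0 add0r clamp0.
- by rewrite ival_one clamp_ge1 ?clamp1 //; lra.
- move=> s; rewrite path_catE /cat_fun addr0; case: ifPn => // hs.
  rewrite [X in _ = p X]clamp_ge1; last by lra.
  by rewrite [RHS]path_one.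
- by [].
Qed.

Lemma path_catpV x y (p : ipath R x y) :
  path_homotopic (path_cat p (path_rev p)) (path_cst R X x).
Proof.
pose phi (s : I) : I := clamp (Num.min (2 * ival s + 0) (- 2 * ival s + 2)).
apply: (@path_reparam p phi (fun=> zero)).
- exact: cts_fun.
- apply: continuous_clamp; apply: continuous_minf;
    by apply: continuous_affine; exact: ival_continuous.
- exact: cst_continuous.
- by rewrite /phi ival_zero !mulr0 !add0r min_l ?clamp0.
- rewrite /phi ival_one min_r; last by lra.
  by rewrite mulr1 addNr clamp0.
- move=> s; rewrite path_catE /cat_fun /phi; case: ifPn => hs.
    by rewrite min_l ?addr0 //; lra.
  rewrite min_r; last by lra.
  rewrite path_revE /irev ival_clamp_id; [|lra|have := ival_le1 s; lra].
  by congr (p (clamp _)); lra.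
- by move=> s; rewrite /= path_zero.
Qed.

Lemma path_revK x y (p : ipath R x y) (s : I) : path_rev (path_rev p) s = p s.
Proof.
rewrite !path_revE /irev ival_clamp_id.
- by rewrite subKr clampK.
- by have := ival_le1 s; lra.
- by have := ival_ge0 s; lra.
Qed.

Lemma path_catVp x y (p : ipath R x y) :
  path_homotopic (path_cat (path_rev p) p) (path_cst R X y).
Proof.
have := path_catpV (path_rev p).
by have -> : path_rev (path_rev p) = p by apply/path_eqP; exact: path_revK.
Qed.

Lemma path_catA x y z w (p : ipath R x y) (q : ipath R y z) (r : ipath R z w) :
  path_homotopic (path_cat p (path_cat q r)) (path_cat (path_cat p q) r).
Proof.
apply: path_homotopic_sym.
pose phi (s : I) : I := clamp
  (Num.min (2 * ival s + 0) (Num.min (1 * ival s + 4^-1) (2^-1 * ival s + 2^-1))).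
apply: (@path_reparam (path_cat p (path_cat q r)) phi id) => //.
- exact: cts_fun.
- apply: continuous_clamp; apply: continuous_minf.
    by apply: continuous_affine; exact: ival_continuous.
  apply: continuous_minf;
    by apply: continuous_affine; exact: ival_continuous.
- by move=> s; exact: cvg_id.
- rewrite /phi ival_zero min_l; first by rewrite mulr0 addr0 clamp0.
  by rewrite le_min; apply/andP; split; lra.
- rewrite /phi ival_one min_r; last by rewrite ge_min; apply/orP; right; lra.
  by rewrite min_r ?clamp_ge1 ?clamp1 //; lra.
- move=> s; have s0 := ival_ge0 s; have s1 := ival_le1 s.
  rewrite !path_catE /cat_fun /phi.
  have [s2|s2] := leP (ival s) 2^-1.
    rewrite path_catE /cat_fun ival_clamp_id; [|lra|lra].
    have [s4|s4] := leP (2 * ival s) 2^-1.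
      rewrite min_l; last by rewrite le_min; apply/andP; split; lra.
      rewrite ival_clamp_id; [|lra|lra].
      by rewrite ifT ?addr0 //; lra.
    rewrite min_r; last by rewrite ge_min; apply/orP; left; lra.
    rewrite min_l; last by lra.
    rewrite ival_clamp_id; [|lra|lra].
    rewrite ifF; last by apply/negbTE; rewrite -ltNge; lra.
    rewrite path_catE /cat_fun ival_clamp_id; [|lra|lra].
    rewrite ifT; last by lra.
    by congr (q (clamp _)); lra.
  rewrite min_r; last by rewrite ge_min; apply/orP; right; lra.
  rewrite min_r; last by lra.
  rewrite ival_clamp_id; [|lra|lra].
  rewrite ifF; last by apply/negbTE; rewrite -ltNge; lra.
  rewrite path_catE /cat_fun ival_clamp_id; [|lra|lra].
  rewrite ifF; last by apply/negbTE; rewrite -ltNge; lra.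
  by congr (r (clamp _)); lra.
Qed.

End HomotopyTheory.

Section PathClass.
Variables (R : realType) (X : topologicalType).
Implicit Types x y z w : X.

Section Quotient.
Variables x y : X.

Definition path_homotopicb : rel (ipath R x y) :=
  fun p q => `[< path_homotopic p q >].

Let homotopicb_refl : reflexive path_homotopicb.
Proof. by move=> p; apply/asboolP; exact: path_homotopic_refl. Qed.

Let homotopicb_sym : symmetric path_homotopicb.
Proof.
by move=> p q; apply/asboolP/asboolP; exact: path_homotopic_sym.
Qed.

Let homotopicb_trans : transitive path_homotopicb.
Proof.
move=> q p r /asboolP pq /asboolP qr; apply/asboolP.
exact: path_homotopic_trans pq qr.
Qed.

Canonical path_homotopic_equiv :=
  EquivRel path_homotopicb homotopicb_refl homotopicb_sym homotopicb_trans.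

Definition path_class : Type := {eq_quot path_homotopic_equiv}.

HB.instance Definition _ := Choice.on path_class.
HB.instance Definition _ := EqQuotient.on path_class.

Definition pclass (p : ipath R x y) : path_class := \pi_path_class p.

Lemma pclassP (p q : ipath R x y) :
  pclass p = pclass q <-> path_homotopic p q.
Proof.
split=> [/eqP|pq]; first by rewrite eqmodE => /asboolP.
by apply/eqP; rewrite eqmodE; exact/asboolP.
Qed.

Lemma pclassK (u : path_class) : pclass (repr u) = u.
Proof. exact: reprK. Qed.

Lemma pclass_ind (P : path_class -> Prop) :
  (forall p, P (pclass p)) -> forall u, P u.
Proof. by move=> Pp u; rewrite -(pclassK u). Qed.

End Quotient.

Definition class_cat x y z (u : path_class x y) (v : path_class y z) :
  path_class x z := pclass (path_cat (repr u) (repr v)).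

Definition class_rev x y (u : path_class x y) : path_class y x :=
  pclass (path_rev (repr u)).

Lemma class_catE x y z (p : ipath R x y) (q : ipath R y z) :
  class_cat (pclass p) (pclass q) = pclass (path_cat p q).
Proof. by apply/pclassP/path_homotopic_cat; apply/pclassP; rewrite pclassK. Qed.

Lemma class_revE x y (p : ipath R x y) :
  class_rev (pclass p) = pclass (path_rev p).
Proof. by apply/pclassP/path_homotopic_rev/pclassP; rewrite pclassK. Qed.

Lemma class_catA x y z w (a : path_class x y) (b : path_class y z)
    (c : path_class z w) :
  class_cat a (class_cat b c) = class_cat (class_cat a b) c.
Proof.
elim/pclass_ind: a => p; elim/pclass_ind: b => q; elim/pclass_ind: c => r.
by rewrite !class_catE; apply/pclassP; exact: path_catA.
Qed.

Lemma class_cat1p x y (a : path_class x y) :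
  class_cat (pclass (path_cst R X x)) a = a.
Proof.
by elim/pclass_ind: a => p; rewrite class_catE; apply/pclassP/path_cat1p.
Qed.

Lemma class_catp1 x y (a : path_class x y) :
  class_cat a (pclass (path_cst R X y)) = a.
Proof.
by elim/pclass_ind: a => p; rewrite class_catE; apply/pclassP/path_catp1.
Qed.

Lemma class_catVp x y (a : path_class x y) :
  class_cat (class_rev a) a = pclass (path_cst R X y).
Proof.
elim/pclass_ind: a => p; rewrite class_revE class_catE.
exact/pclassP/path_catVp.
Qed.

Lemma class_catpV x y (a : path_class x y) :
  class_cat a (class_rev a) = pclass (path_cst R X x).
Proof.
elim/pclass_ind: a => p; rewrite class_revE class_catE.
exact/pclassP/path_catpV.
Qed.

Definition pi1 x : Type := path_class x x.

HB.instance Definition _ x := Choice.on (pi1 x).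
HB.instance Definition _ x := @isGroup.Build (pi1 x)
  (pclass (path_cst R X x)) (@class_rev x x) (@class_cat x x x)
  (@class_catA x x x x) (@class_cat1p x x) (@class_catp1 x x)
  (@class_catVp x x) (@class_catpV x x).

End PathClass.

Section InducedMap.
Variables (R : realType) (X Y : topologicalType) (f : X -> Y).
Hypothesis cf : continuous f.

Section PathMap.
Variables (x y : X) (p : ipath R x y).

Let map_continuous : continuous (f \o p).
Proof. by apply: continuous_after cf; exact: cts_fun. Qed.

Let map_zero : (f \o p) zero = f x.
Proof. by rewrite /= path_zero. Qed.

Let map_one : (f \o p) one = f y.
Proof. by rewrite /= path_one. Qed.

Definition ipath_map : ipath R (f x) (f y) :=
  mk_path map_continuous map_zero map_one.

End PathMap.

Lemma path_homotopic_map (x y : X) (p q : ipath R x y) :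
  path_homotopic p q -> path_homotopic (ipath_map p) (ipath_map q).
Proof.
move=> [F [cF F0 F1 Fx Fy]]; exists (f \o F); split => /=.
- exact: continuous_after cF cf.
- by move=> s; rewrite F0.
- by move=> s; rewrite F1.
- by move=> t; rewrite Fx.
- by move=> t; rewrite Fy.
Qed.

Definition pi1_map (x : X) (u : pi1 R x) : pi1 R (f x) :=
  pclass (ipath_map (repr u)).

Lemma pi1_mapE (x : X) (p : ipath R x x) :
  pi1_map (pclass p) = pclass (ipath_map p).
Proof. by apply/pclassP/path_homotopic_map/pclassP; rewrite pclassK. Qed.

End InducedMap.

Lemma set_val_continuous (X : topologicalType) (U : set X) :
  continuous (set_val : U -> X).
Proof. exact: initial_continuous. Qed.

Definition path_connected (R : realType) (X : topologicalType) : Prop :=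
  forall x y : X, inhabited (ipath R x y).

Section RelativeProperties.
Variables (R : realType) (X : topologicalType).
Implicit Types (x y : X) (U V : set X).

Definition mulset (G : groupType) (A B : set G) : set G :=
  [set (a * b)%g | a in A & b in B].

(* The image of pi_1(U, y), where U coerces to the type of its points with the
   subspace topology; [set_val] maps the base point of U to y by conversion. *)
Definition incl_pi1 U y (Uy : U y) : set (pi1 R y) :=
  range (pi1_map (@set_val_continuous X U) (x := SigSub (mem_set Uy))).

(* The subgroup pi(alpha, V). *)
Definition tail_pi1 x y (alpha : ipath R x y) V : set (pi1 R x) :=
  [set g | exists2 delta : ipath R y y, range delta `<=` V &
    g = pclass (path_cat (path_cat alpha delta) (path_rev alpha))].

Variables (x0 : X) (H : set (pi1 R x0)).

Definition path_coset y (beta : ipath R x0 y) : set (path_class R x0 y) :=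
  [set class_cat h (pclass beta) | h in H].

Definition locally_quasinormal : Prop :=
  forall y (alpha : ipath R x0 y) U, open U -> U y ->
  exists V, [/\ open V, V y, V `<=` U &
    mulset H (tail_pi1 alpha V) = mulset (tail_pi1 alpha V) H].

Definition small_loop_transfer : Prop :=
  forall y (alpha : ipath R x0 y) U (Ux0 : U x0), open U ->
  exists V, [/\ open V, V y &
    tail_pi1 alpha V `<=` mulset H (incl_pi1 Ux0)].

Definition homotopically_hausdorff : Prop :=
  forall y (alpha : ipath R x0 y) (g : pi1 R x0), ~ H g ->
  exists U, [/\ open U, U y &
    tail_pi1 alpha U `&` mulset H [set g] = set0].

(* Only t_0, ..., t_n and U_0, ..., U_(n-1) matter: the open sets are indexed
   by the left endpoints of the subintervals. *)
Definition homotopically_path_hausdorff : Prop :=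
  forall y (alpha beta : ipath R x0 y), ~ path_coset beta (pclass alpha) ->
  exists (n : nat) (t : nat -> unitI R) (U : nat -> set X),
  [/\ t 0%N = zero, t n = one,
      forall i, (i < n)%N -> ival (t i) < ival (t i.+1),
      forall i, (i < n)%N -> open (U i) /\
        alpha @` [set s | ival (t i) <= ival s <= ival (t i.+1)] `<=` U i &
      forall lambda : ipath R x0 y,
        (forall i, (i < n)%N ->
          lambda @` [set s | ival (t i) <= ival s <= ival (t i.+1)] `<=` U i) ->
        (forall i, (i <= n)%N -> lambda (t i) = alpha (t i)) ->
        ~ path_coset beta (pclass lambda)].

End RelativeProperties.

(* Main.v *)
(* Let g = [beta][alpha]^-1, which is not in H.  The Hausdorff property at the
   constant path, followed by local quasinormality, gives an open neighbourhood
   U of x0 such that K = H pi(U) is a subgroup and pi(U) does not meet Hg.  By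
   small loop transfer every alpha(t) has a neighbourhood whose loops, conjugated
   along alpha, lie in K, and by compactness finitely many of them follow alpha.
   For a path lambda subordinate to them, [lambda][alpha]^-1 is a product of such
   conjugated loops, hence lies in K.  If [lambda] were in H[beta], then Hg would
   meet K, hence pi(U). *)
Require Import Defs.
From mathcomp Require Import all_boot all_order all_algebra.
From mathcomp Require Import all_classical all_reals all_analysis homotopy.
From mathcomp Require Import lra.
Set Implicit Arguments.
Unset Strict Implicit.
Unset Printing Implicit Defensive.
Import Order.TTheory GRing.Theory Num.Theory.
Import numFieldNormedType.Exports.

(** * Groupoid calculus of path classes and of the groups pi(alpha, V) *)

Section PathClassGroupoid.
Variables (R : realType) (X : topologicalType).
Implicit Types x y z w : X.

Lemma class_catVK x y z (a : path_class R x y) (b : path_class R y z) :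
  class_cat (class_rev a) (class_cat a b) = b.
Proof. by rewrite class_catA class_catVp class_cat1p. Qed.

Lemma class_catKV x y z (a : path_class R y x) (b : path_class R y z) :
  class_cat a (class_cat (class_rev a) b) = b.
Proof. by rewrite class_catA class_catpV class_cat1p. Qed.

Lemma class_rev_cat x y z (a : path_class R x y) (b : path_class R y z) :
  class_rev (class_cat a b) = class_cat (class_rev b) (class_rev a).
Proof.
rewrite -[RHS](class_catVK (class_cat a b)) -(class_catA a b) class_catKV.
by rewrite class_catpV class_catp1.
Qed.

Lemma class_rev_cst x :
  class_rev (pclass (path_cst R X x)) = pclass (path_cst R X x).
Proof. by rewrite -[LHS]class_cat1p class_catpV. Qed.

Lemma tail_pi1P x y (a : ipath R x y) V g : tail_pi1 a V g <->
  exists2 d : ipath R y y, (range d `<=` V)%classic &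
    g = class_cat (class_cat (pclass a) (pclass d)) (class_rev (pclass a)).
Proof.
by split=> -[d dV ->]; exists d; rewrite ?class_revE ?class_catE.
Qed.

Lemma range_path_cat x y z (p : ipath R x y) (q : ipath R y z) V :
  (range p `<=` V)%classic -> (range q `<=` V)%classic ->
  (range (path_cat p q) `<=` V)%classic.
Proof.
move=> pV qV _ [s _ <-]; rewrite path_catE /cat_fun.
by case: ifP => _; [apply: pV|apply: qV]; apply: imageT.
Qed.

Lemma range_path_rev x y (p : ipath R x y) V :
  (range p `<=` V)%classic -> (range (path_rev p) `<=` V)%classic.
Proof. by move=> pV _ [s _ <-]; rewrite path_revE; apply/pV/imageT. Qed.

(** Conjugating [d] along [b] is conjugating [c d c^-1] along [a], and the latter loop stays in [V].
    This moves a neighbourhood from one point of a path to a nearby one. *)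
Lemma tail_pi1_extend x y z (a : ipath R x y) (b : ipath R x z)
    (c : ipath R y z) V :
  pclass b = class_cat (pclass a) (pclass c) -> (range c `<=` V)%classic ->
  (tail_pi1 b V `<=` tail_pi1 a V)%classic.
Proof.
move=> bE cV g /tail_pi1P[d dV ->]; apply/tail_pi1P.
exists (path_cat (path_cat c d) (path_rev c)).
  by do 2?apply: range_path_cat => //; exact: range_path_rev.
by rewrite -!class_catE -class_revE bE class_rev_cat -!class_catA.
Qed.

Lemma tail_pi1_cst x V (g : pi1 R x) : tail_pi1 (path_cst R X x) V g <->
  exists2 d : ipath R x x, (range d `<=` V)%classic & g = pclass d.
Proof.
split=> [/tail_pi1P|] [d dV ->].
  by exists d => //; rewrite class_cat1p class_rev_cst class_catp1.
by apply/tail_pi1P; exists d => //; rewrite class_cat1p class_rev_cst class_catp1.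
Qed.

Lemma tail_pi1_cstM x V (g h : pi1 R x) :
  tail_pi1 (path_cst R X x) V g -> tail_pi1 (path_cst R X x) V h ->
  tail_pi1 (path_cst R X x) V (g * h)%g.
Proof.
move=> /tail_pi1_cst[d dV ->] /tail_pi1_cst[e eV ->]; apply/tail_pi1_cst.
by exists (path_cat d e); [exact: range_path_cat|exact: class_catE].
Qed.

Lemma tail_pi1_cst1 x (V : set X) : V x ->
  tail_pi1 (path_cst R X x) V (1%g : pi1 R x).
Proof.
by move=> Vx; apply/tail_pi1_cst; exists (path_cst R X x) => // _ [s _ <-].
Qed.

(** Brings what small loop transfer yields into the form in which the Hausdorff and quasinormality
    conditions are used, namely pi of the constant path. *)
Lemma incl_pi1_tail x (V : set X) (Vx : V x) :
  (incl_pi1 (R := R) Vx `<=` tail_pi1 (path_cst R X x) V)%classic.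
Proof.
move=> g [u _ <-]; apply/tail_pi1_cst.
exists (ipath_map (@set_val_continuous X V) (repr u)) => //.
by move=> _ [s _ <-] /=; exact: set_valP.
Qed.

End PathClassGroupoid.

(** * Subpaths and their homotopy classes *)

Section Subpaths.
Variable R : realType.
Local Notation I := (unitI R).
Local Open Scope ring_scope.

(** No order between [s] and [u] is imposed, so that the reverse of a subpath is again a subpath. *)
Definition unit_segment (s u r : I) : I :=
  clamp (ival s + ival r * (ival u - ival s)).

Lemma ival_unit_segment s u r :
  ival (unit_segment s u r) = ival s + ival r * (ival u - ival s).
Proof.
have := (ival_ge0 s, ival_le1 s, ival_ge0 u, ival_le1 u, ival_ge0 r, ival_le1 r).
by move=> [[[[[? ?] ?] ?] ?] ?]; rewrite ival_clamp_id //; nra.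
Qed.

Lemma unit_segment_continuous s u : continuous (unit_segment s u).
Proof.
have -> : unit_segment s u =
    fun r => clamp ((ival u - ival s) * ival r + ival s).
  by apply/funext => r; rewrite /unit_segment addrC mulrC.
by apply: continuous_clamp; apply: continuous_affine; exact: ival_continuous.
Qed.

Lemma unit_segment_zero s u : unit_segment s u zero = s.
Proof. by rewrite /unit_segment ival_zero mul0r addr0 clampK. Qed.

Lemma unit_segment_one s u : unit_segment s u one = u.
Proof. by rewrite /unit_segment ival_one mul1r addrC subrK clampK. Qed.

Lemma unit_segment_01 r : unit_segment zero one r = r.
Proof. by rewrite /unit_segment ival_zero ival_one subr0 mulr1 add0r clampK. Qed.

Lemma unit_segment_irev s u r : unit_segment s u (irev r) = unit_segment u s r.
Proof.
apply: ival_inj; rewrite !ival_unit_segment ival_clamp_id; first by lra.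
  by have := ival_le1 r; lra.
by have := ival_ge0 r; lra.
Qed.

Lemma unit_segment_itv s u r (a b : R) :
  a <= ival s <= b -> a <= ival u <= b -> a <= ival (unit_segment s u r) <= b.
Proof.
have := (ival_ge0 r, ival_le1 r).
move=> [? ?] /andP[? ?] /andP[? ?]; rewrite ival_unit_segment.
by apply/andP; split; nra.
Qed.

Lemma clamp_dist (q r : R) : 0 <= r <= 1 -> `|ival (clamp q) - r| <= `|q - r|.
Proof.
move=> /andP[r0 r1]; rewrite ival_clamp ler_norml.
have := ler_norm (q - r); have := ler_norm (- (q - r)); rewrite normrN.
by case: (leP q 1) => ?; rewrite ?(max_r ler01) => *; case: (leP 0 q) => ?;
  apply/andP; split; lra.
Qed.

Variable X : topologicalType.

(* The endpoints are arbitrary names a, b for p s and p u, so that subpaths of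
   different paths can be concatenated without transport. *)
Section Subpath.
Variables (x y a b : X) (p : ipath R x y) (s u : I).
Hypotheses (psa : p s = a) (pub : p u = b).

Let subpath_continuous : continuous (p \o unit_segment s u).
Proof. by apply: continuous_after (@unit_segment_continuous s u) _; exact: cts_fun. Qed.

Let subpath_zero : (p \o unit_segment s u) zero = a.
Proof. by rewrite /= unit_segment_zero. Qed.

Let subpath_one : (p \o unit_segment s u) one = b.
Proof. by rewrite /= unit_segment_one. Qed.

Definition subpath : ipath R a b :=
  mk_path subpath_continuous subpath_zero subpath_one.

Lemma subpathE r : subpath r = p (unit_segment s u r).
Proof. by []. Qed.

Lemma range_subpath (c d : R) V :
  c <= ival s <= d -> c <= ival u <= d ->
  (forall r : I, c <= ival r <= d -> V (p r)) -> (range subpath `<=` V)%classic.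
Proof.
by move=> sI uI pV _ [r _ <-]; rewrite subpathE; apply/pV/unit_segment_itv.
Qed.

End Subpath.

Lemma subpath_full x y (p : ipath R x y) (e0 : p zero = x) (e1 : p one = y) :
  subpath e0 e1 = p.
Proof. by apply/path_eqP => r; rewrite subpathE unit_segment_01. Qed.

Lemma subpath_cst x y (p : ipath R x y) s a (ea eb : p s = a) :
  subpath ea eb = path_cst R X a.
Proof.
apply/path_eqP => r; rewrite subpathE -ea /unit_segment.
by rewrite subrr mulr0 addr0 clampK.
Qed.

(** Renames the point where two subpaths meet. The name occurs in the types of both factors, so they
    must change together. *)
Lemma class_subpath_meet x y z w (p : ipath R x y) (q : ipath R z w)
    (s u s' u' : I) a c b b' (pa : p s = a) (pb : p u = b) (pb' : p u = b')
    (qb : q s' = b) (qb' : q s' = b') (qc : q u' = c) :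
  class_cat (pclass (subpath pa pb)) (pclass (subpath qb qc)) =
  class_cat (pclass (subpath pa pb')) (pclass (subpath qb' qc)).
Proof.
have bb' : b = b' by rewrite -pb.
move: pb' qb'; rewrite -bb' => pb' qb'.
have -> : subpath pa pb = subpath pa pb' by exact/path_eqP.
by have -> : subpath qb qc = subpath qb' qc by exact/path_eqP.
Qed.

(** Both sides are [p] after reparametrizations of the interval with the same endpoints, which are
    joined by a straight-line homotopy. *)
Lemma class_subpath_cat x y (p : ipath R x y) (s u v : I) a b c
    (es : p s = a) (eu : p u = b) (ev : p v = c) :
  class_cat (pclass (subpath es eu)) (pclass (subpath eu ev)) =
  pclass (subpath es ev).
Proof.
rewrite class_catE; apply/pclassP.
apply: (@path_reparam _ _ p (cat_fun (unit_segment s u) (unit_segment u v))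
          (unit_segment s v)) => //.
- exact: cts_fun.
- apply: cat_fun_continuous; [exact: unit_segment_continuous..|].
  by rewrite unit_segment_one unit_segment_zero.
- exact: unit_segment_continuous.
- by rewrite cat_fun_zero !unit_segment_zero.
- by rewrite cat_fun_one !unit_segment_one.
- by move=> r; rewrite path_catE /cat_fun !subpathE; case: ifP.
Qed.

Lemma class_subpath_rev x y (p : ipath R x y) (s u : I) a b
    (es : p s = a) (eu : p u = b) :
  class_rev (pclass (subpath es eu)) = pclass (subpath eu es).
Proof.
rewrite class_revE; congr pclass; apply/path_eqP => r.
by rewrite path_revE !subpathE unit_segment_irev.
Qed.

End Subpaths.

(** * Compactness along [alpha] and the telescoping product *)

Section SmallTails.
Variables (R : realType) (X : topologicalType) (x0 y : X) (alpha : ipath R x0 y).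
Variable K : set (pi1 R x0).
Local Notation I := (unitI R).
Local Open Scope ring_scope.
Local Open Scope classical_set_scope.

Local Notation initial s := (subpath (path_zero (s := alpha)) (erefl (alpha s))).

Hypothesis small_tail : forall s, exists V,
  [/\ open V, V (alpha s) & tail_pi1 (initial s) V `<=` K].

(** A Lebesgue number argument: the neighbourhood found at one parameter also serves the nearby
    ones. *)
Lemma uniformly_small_tails : exists n : nat, forall s : I, exists V,
  [/\ open V, forall u : I, `|ival u - ival s| <= n.+1%:R^-1 -> V (alpha u) &
    tail_pi1 (initial s) V `<=` K].
Proof.
pose P (n : nat) (r : R) := exists V,
  [/\ open V, forall u : I, `|ival u - r| <= n.+1%:R^-1 -> V (alpha u) &
    tail_pi1 (initial (clamp r)) V `<=` K].
(* If [P n q] holds for [q] near each [r] and all large [n], compactness provides one [n] for the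
   whole segment. *)
have /compact_near_coveringP/(_ nat \oo P _) := @segment_compact R 0 1.
case=> [r /= |N _ /(_ N (leqnn N)) PN]; last first.
  exists N => s; have [|V [oV sV VK]] := PN (ival s).
    by rewrite /= in_itv /= ival_ge0 ival_le1.
  by exists V; rewrite clampK in VK; split.
rewrite in_itv /= => r01.
have [V [oV Vr VK]] := small_tail (clamp r).
have : nbhs r (fun q : R => V (alpha (clamp q))).
  have ca : continuous (fun q : R => alpha (clamp q)).
    by apply: continuous_after (@clamp_continuous R) _; exact: cts_fun.
  by apply: ca; exact: open_nbhs_nbhs.
move=> /nbhs_ballP[e /= e0 eV].
have aV (u : I) : `|ival u - r| < e -> V (alpha u).
  by move=> ur; rewrite -(clampK u); apply: eV; rewrite /ball /= distrC.
(* One half of [e] bounds the distance from [q] to [r], the other the radius around [q]. *)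
have e20 : 0 < e / 2 by lra.
exists ([set q | `|q - r| < e / 2], [set n : nat | (n.+1%:R^-1 : R) < e / 2]).
  split => /=; last exact: (near_infty_natSinv_lt (PosNum e20)).
  by apply/nbhs_ballP; exists (e / 2) => // q; rewrite /ball /= distrC.
move=> [q n] /= [qr ne].
have rr : ival (clamp r) = r by move: r01 => /andP[? ?]; rewrite ival_clamp_id.
exists V; split=> // [u un|].
  apply: aV; rewrite [e]splitr; apply: le_lt_trans (ler_distD q _ _) _.
  by apply: ltrD => //; exact: le_lt_trans ne.
(* The real number [q] may lie outside the unit interval; clamping does not move it away from [r].
   The piece of [alpha] between the two parameters stays in [V]. *)
have {}qr := le_lt_trans (clamp_dist q r01) qr.
apply: subset_trans VK.
apply: (tail_pi1_extend (c := subpath (erefl (alpha (clamp r)))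
                                      (erefl (alpha (clamp q))))).
  by rewrite class_subpath_cat.
apply: (range_subpath (c := r - e / 2) (d := r + e / 2)).
- by rewrite rr; apply/andP; split; lra.
- by move: qr; rewrite ltr_distl => /andP[? ?]; apply/andP; split; lra.
- move=> u /andP[? ?]; apply: aV; rewrite ltr_distl; apply/andP; split; lra.
Qed.

(* The loops at alpha (t i) that run along lambda and back along alpha telescope to
   [lambda][alpha]^-1. *)
Lemma telescope_tails n (t : nat -> I) (V : nat -> set X) (lambda : ipath R x0 y)
    (la : forall i, (i <= n)%N -> lambda (t i) = alpha (t i)) :
  K 1%g -> (forall g h, K g -> K h -> K (g * h)%g) ->
  t 0%N = zero -> t n = one ->
  (forall i, (i < n)%N -> ival (t i) <= ival (t i.+1)) ->
  (forall i, (i < n)%N -> [/\ tail_pi1 (initial (t i)) (V i) `<=` K,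
    alpha @` [set s | ival (t i) <= ival s <= ival (t i.+1)] `<=` V i &
    lambda @` [set s | ival (t i) <= ival s <= ival (t i.+1)] `<=` V i]) ->
  K (class_cat (pclass lambda) (class_rev (pclass alpha))).
Proof.
move=> K1 KM t0 tn tS tV.
have catK (g h : pi1 R x0) : K g -> K h -> K (class_cat g h) by exact: KM.
have main i (lei : (i <= n)%N) :
    K (class_cat (pclass (subpath (path_zero (s := lambda)) (la i lei)))
                 (class_rev (pclass (initial (t i))))).
  elim: i lei => [|i IH] lei.
    (* Once the meeting point is renamed to [x0], both pieces are constant paths. *)
    move: (la 0%N lei); rewrite t0 => la0; rewrite class_subpath_rev.
    rewrite (class_subpath_meet _ _ (path_zero (s := lambda))
                                _ (path_zero (s := alpha))).
    by rewrite !subpath_cst class_cat1p.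
  have [tK aV lV] := tV i lei.
  set mu := subpath (la i (ltnW lei)) (la i.+1 lei).
  set nu := subpath (erefl (alpha (t i))) (erefl (alpha (t i.+1))).
  have KT : K (class_cat (class_cat (pclass (initial (t i)))
      (pclass (path_cat mu (path_rev nu)))) (class_rev (pclass (initial (t i))))).
    apply: tK; apply/tail_pi1P; exists (path_cat mu (path_rev nu)) => //.
    have titi := tS i lei.
    apply: range_path_cat; last apply: range_path_rev;
      apply: (range_subpath (c := ival (t i)) (d := ival (t i.+1)));
      rewrite ?lexx ?titi // => r rI; [apply: lV|apply: aV]; exact: imageP.
  (* With l and a the pieces of [lambda] and [alpha] up to [t i], this is (l a^-1)(a mu nu^-1 a^-1)
     = (l mu)(a nu)^-1. *)
  have := catK _ _ (IH (ltnW lei)) KT; congr K.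
  rewrite -(class_subpath_cat (path_zero (s := lambda)) (la i (ltnW lei))
             (la i.+1 lei)).
  rewrite -(class_subpath_cat (path_zero (s := alpha)) (erefl (alpha (t i)))
             (erefl (alpha (t i.+1)))).
  rewrite class_rev_cat -class_catE -class_revE.
  by rewrite -!class_catA class_catVK.
(* The meeting point [alpha one] is renamed to [y], so that the pieces become the full paths. *)
have := main n (leqnn n); move: (la n (leqnn n)); rewrite tn => lan.
rewrite class_subpath_rev.
rewrite (class_subpath_meet _ _ (path_one (s := lambda))
                            _ (path_one (s := alpha))).
rewrite -(class_subpath_rev (path_zero (s := alpha)) (path_one (s := alpha))).
by rewrite !subpath_full.
Qed.

End SmallTails.

(** * Products of commuting sets in a group *)

Section ProductSets.
Local Open Scope classical_set_scope.

(** In [a * b * c * d] the middle product [b * c] lies in BA = AB and is rewritten as [c' * b']. *)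
Lemma mulset_closedM (G : groupType) (A B : set G) :
  (forall a b, A a -> A b -> A (a * b)%g) ->
  (forall a b, B a -> B b -> B (a * b)%g) ->
  mulset A B = mulset B A ->
  forall a b, mulset A B a -> mulset A B b -> mulset A B (a * b)%g.
Proof.
move=> AM BM AB _ _ [a Aa [b Bb <-]] [c Ac [d Bd <-]].
have : mulset B A (b * c)%g by exists b => //; exists c.
rewrite -AB => -[c' Ac' [b' Bb' bc]].
exists (a * c')%g; first exact: AM.
exists (b' * d)%g; first exact: BM.
by rewrite -!mulgA; congr (_ * _)%g; rewrite !mulgA bc.
Qed.

End ProductSets.

Theorem theorem3p4 (R : realType) (X : topologicalType) (x0 : X)
    (H : set (pi1 R x0)) :
  path_connected R X -> group_closed [in H] ->
  small_loop_transfer H -> locally_quasinormal H ->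
  homotopically_hausdorff H -> homotopically_path_hausdorff H.
Proof.
move=> _ Hgrp slt lqn hh y alpha beta nab.
have H1 : H 1%g by have /set_mem := Hgrp.1.
have HV g : H g -> H (g^-1)%g.
  by move=> Hg; apply/set_mem; apply: group_closedV Hgrp g (mem_set Hg).
have HM g h : H g -> H h -> H (g * h)%g.
  move=> Hg Hh; apply/set_mem.
  by apply: group_closedM Hgrp g h (mem_set Hg) (mem_set Hh).
pose g : pi1 R x0 := class_cat (pclass beta) (class_rev (pclass alpha)).
have nHg : ~ H g.
  move=> /HV Hg; apply: nab; exists (g^-1)%g => //.
  have -> : pclass beta = class_cat g (pclass alpha).
    by rewrite /g -class_catA class_catVp class_catp1.
  exact: class_catVK.
have [U1 [oU1 U1x gU1]] := hh _ (path_cst R X x0) g nHg.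
have [U [oU Ux UU1 HU]] := lqn _ (path_cst R X x0) U1 oU1 U1x.
pose K := mulset H (tail_pi1 (path_cst R X x0) U).
have KM := mulset_closedM HM (@tail_pi1_cstM _ _ _ U) HU.
have K1 : K 1%g.
  by exists 1%g => //; exists 1%g; [exact: tail_pi1_cst1|exact: mulg1].
have small s : exists V : set X, [/\ open V, V (alpha s) &
    (tail_pi1 (subpath (path_zero (s := alpha)) (erefl (alpha s))) V `<=` K)%classic].
  have [V [oV Vs VH]] :=
    slt _ (subpath (path_zero (s := alpha)) (erefl (alpha s))) U Ux oU.
  exists V; split=> // _ /VH[h Hh [u Uu <-]].
  by exists h => //; exists u => //; exact: incl_pi1_tail Uu.
have [n Pn] := uniformly_small_tails small.
pose t (i : nat) : unitI R := clamp (i%:R / n.+1%:R)%R.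
have [V VP] := choice (fun i => Pn (t i)).
have tE i : (i <= n.+1)%N -> ival (t i) = (i%:R / n.+1%:R)%R.
  by move=> lei; rewrite ival_clamp_id // ?divr_ge0// ler_pdivrMr// mul1r ler_nat.
have tS i : (i < n.+1)%N -> ival (t i.+1) = (ival (t i) + n.+1%:R^-1)%R.
  by move=> lti; rewrite !tE ?(ltnW lti)// -natr1 mulrDl mul1r.
have n0 : (0 < n.+1%:R^-1 :> R)%R by rewrite invr_gt0.
have t0 : t 0%N = zero by rewrite /t mul0r clamp0.
have t1 : t n.+1 = one by rewrite /t divff ?pnatr_eq0// clamp1.
have aV i : (i < n.+1)%N ->
    (alpha @` [set s | (ival (t i) <= ival s <= ival (t i.+1))%R] `<=` V i)%classic.
  move=> lti _ [s /= /andP[s1 s2] <-]; have [_ + _] := VP i; apply.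
  by rewrite ger0_norm ?subr_ge0// lerBlDl -tS.
exists n.+1, t, V; split=> //.
- by move=> i lti; rewrite tS// ltrDl.
- by move=> i lti; split; [have [] := VP i|exact: aV].
move=> lambda lV la [h Hh lE].
have : K (class_cat (pclass lambda) (class_rev (pclass alpha))).
  apply: (telescope_tails (t := t) (V := V) la) => // i lti.
    by rewrite tS// lerDl ltW.
  by split; [have [] := VP i|exact: aV|exact: lV].
(* If [lambda] = h [beta], then [lambda][alpha]^-1 = h g = k u, hence u = (k^-1 h) g lies in Hg. *)
rewrite -lE -class_catA -/g => -[k Hk [u Uu ku]].
suff : (tail_pi1 (path_cst R X x0) U1 `&` mulset H [set g])%classic u by rewrite gU1.
split.
  by case: Uu => d dU ->; exists d => //; apply: subset_trans UU1.
exists (k^-1 * h)%g; first by apply: HM => //; exact: HV.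
exists g => //.
by rewrite -mulgA -(mulKg k u) ku.
Qed.
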